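(* Let $(M,g)$ be a space-time and let $V$ be a globally defined time-like vector field on $M$. For each admissible pair $(\alpha,\beta)$ and each choice of signs $(\epsilon_1,\epsilon_2)\in\{+1,-1\}^2$, define $\overrightarrow{D}^{(\alpha,\beta)}_{\{\epsilon_1,\epsilon_2\}}:\Gamma(TM)\to\Gamma(TM)$ and $\widetilde{D}^{(\alpha,\beta)}_{\{\epsilon_1,\epsilon_2\}}:\Gamma(T^*M)\to\Gamma(T^*M)$ by $$\overrightarrow{D}^{(\alpha,\beta)}_{\{\epsilon_1,\epsilon_2\}}(X)=\epsilon_1\sqrt{\alpha+\beta}\,X_{\parallel}+\epsilon_2\sqrt{\alpha}\,X_{\perp},\qquad \widetilde{D}^{(\alpha,\beta)}_{\{\epsilon_1,\epsilon_2\}}(\omega)=\frac{\epsilon_1}{\sqrt{\alpha+\beta}}\,\omega_{\parallel}+\frac{\epsilon_2}{\sqrt{\alpha}}\,\omega_{\perp}.$$ (1) Among the four sign choices, $(\epsilon_1,\epsilon_2)=(+1,+1)$ is the only one for which both of the following hold: (a) for every admissible pair $(\alpha,\beta)$ and all $Y,Z\in\Gamma(TM)$, $$\widehat{g}(Y,Z)=g\left(\overrightarrow{D}^{(\alpha,\beta)}_{\{\epsilon_1,\epsilon_2\}}(Y),\overrightarrow{D}^{(\alpha,\beta)}_{\{\epsilon_1,\epsilon_2\}}(Z)\right);$$ (b) the family $\{\overrightarrow{D}^{(\alpha,\beta)}_{\{\epsilon_1,\epsilon_2\}} : (\alpha,\beta)\text{ admissible}\}$ is an Abelian group under composition of maps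 (in particular, it is closed under composition). (2) Likewise, among the four sign choices, $(\epsilon_1,\epsilon_2)=(+1,+1)$ is the only one for which both of the following hold: (a) for every admissible pair $(\alpha,\beta)$ and all $\omega,\eta\in\Gamma(T^*M)$, $$\widehat{h}(\omega,\eta)=h\left(\widetilde{D}^{(\alpha,\beta)}_{\{\epsilon_1,\epsilon_2\}}(\omega),\widetilde{D}^{(\alpha,\beta)}_{\{\epsilon_1,\epsilon_2\}}(\eta)\right);$$ (b) the family $\{\widetilde{D}^{(\alpha,\beta)}_{\{\epsilon_1,\epsilon_2\}} : (\alpha,\beta)\text{ admissible}\}$ is an Abelian group under composition of maps.
   Context: A space-time $(M,g)$ is a (nonempty, smooth, time-orientable) four-dimensional manifold with a Lorentzian metric $g$ of signature $(+,-,-,-)$; a vector field $V$ is time-like if $g(V,V)>0$ everywhere. $\Gamma(TM)$ and $\Gamma(T^*M)$ denote smooth vector fields and smooth 1-forms. An admissible pair $(\alpha,\beta)$ is a pair of smooth real-valued functions on $M$ with $\alpha>0$ and $\alpha+\beta>0$ everywhere. For $X\in\Gamma(TM)$: $X_{\parallel}=\frac{g(X,V)}{g(V,V)}V$ and $X_{\perp}=X-X_{\parallel}$. The co-metric $h$ is the metric induced by $g$ on 1-forms, i.e. $h(g(X,\cdot),g(Y,\cdot))=g(X,Y)$, and $\widetilde V=g(V,\cdot)$. For $\omega\in\Gamma(T^*M)$: $\omega_{\parallel}=\frac{h(\omega,\widetilde V)}{h(\widetilde V,\widetilde V)}\widetilde V$ and $\omega_{\perp}=\omega-\omega_{\parallel}$.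 For an admissible pair $(\alpha,\beta)$, the disformal metric is $$\widehat{g}(Y,Z)=\alpha\, g(Y,Z)+\frac{\beta}{g(V,V)}\,g(V,Y)\,g(V,Z),$$ and the disformal co-metric is $$\widehat{h}(\omega,\eta)=\frac{1}{\alpha}h(\omega,\eta)-\frac{\beta}{\alpha(\alpha+\beta)}\frac{h(\widetilde V,\omega)\,h(\widetilde V,\eta)}{h(\widetilde V,\widetilde V)}.$$ *)

(* Defs.v *)
From HB Require Import structures.
From mathcomp Require Import all_boot all_order all_algebra.
From mathcomp Require Import all_classical all_reals all_analysis.
From mathcomp Require Import ring.
Import Order.TTheory GRing.Theory Num.Theory.
Import numFieldNormedType.Exports.

Set Implicit Arguments.
Unset Strict Implicit.
Unset Printing Implicit Defensive.

Local Open Scope classical_set_scope.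
Local Open Scope ring_scope.

Section Smooth.
Context {R : realType}.

(* Class C^k on an open set [U]: the k-th iterated directional derivatives exist
   (in the Frechet sense at each stage) and are continuous. *)
Fixpoint Ck {V W : normedModType R} (k : nat) (U : set V) (f : V -> W) : Prop :=
  match k with
  | 0 => forall x, U x -> {for x, continuous f}
  | k'.+1 => (forall x, U x -> differentiable f x) /\
             (forall v, Ck k' U ('D_v f))
  end.

Definition smooth_on {V W : normedModType R} (U : set V) (f : V -> W) : Prop :=
  forall k, Ck k U f.

Lemma near_eq_differentiable (V W : normedModType R) (f g : V -> W) x :
  (\forall x \near x, f x = g x) -> differentiable f x -> differentiable g x.
Proof.
move=> fg /diff_locallyP[cf df].
have fgx : f x = g x by exact: nbhs_singleton fg.
have dg : g \o shift x = cst (g x) + 'd f x +o_ (0 : V) id.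
  apply/eqaddoP => e e0; move/eqaddoP: df => /(_ e e0).
  have fg0 : \forall y \near (0 : V), f (y + x) = g (y + x).
    by move: fg; rewrite (near_shift 0) subr0.
  by apply: filterS2 fg0 => y; rewrite /= fgx !fctE /= /shift /= => ->.
have E := diff_unique cf dg.
by apply/diff_locallyP; rewrite E.
Qed.

Lemma Ck_eq (V W : normedModType R) k (U : set V) (f g : V -> W) :
  open U -> (forall x, U x -> f x = g x) -> Ck k U f -> Ck k U g.
Proof.
move=> oU; have nfg f' g' x : (forall x, U x -> f' x = g' x :> W) -> U x -> \forall y \near x, f' y = g' y.
  by move=> fg Ux; move: (open_nbhs_nbhs (conj oU Ux)); apply: filterS => y /fg.
elim: k f g => [|k IH] f g fg /=.
  move=> cf x Ux.
  have := cf x Ux; rewrite /prop_for /continuous_at (fg _ Ux) => cfx.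
  apply: cvg_trans cfx; apply: near_eq_cvg; exact: nfg.
move=> [df cf]; split=> [x Ux|v].
  by apply: near_eq_differentiable (df x Ux); exact: nfg.
apply: IH (cf v) => x Ux; apply: near_eq_derive; exact: nfg.
Qed.

Lemma CkW (V W : normedModType R) k (U : set V) (f : V -> W) :
  Ck k.+1 U f -> Ck k U f.
Proof.
elim: k f => [|k IH] f [df cf] /=.
  by move=> x Ux; exact/differentiable_continuous/df.
by split=> // v; exact: IH.
Qed.

Lemma Ck_cst (V W : normedModType R) k (U : set V) (a : W) : Ck k U (cst a : V -> W).
Proof.
elim: k a => [|k IH] a /=; first by move=> x _; exact: cvg_cst.
split=> [x _|v]; first exact: differentiable_cst.
by rewrite (_ : 'D_v (cst a) = cst 0); [exact: IH|apply/funext => x; rewrite derive_cst].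
Qed.

Section algebra.
Context {V : normedModType R} (U : set V).
Hypothesis oU : open U.
Implicit Types f g : V -> R.

Lemma CkD k f g : Ck k U f -> Ck k U g -> Ck k U (f \+ g).
Proof.
elim: k f g => [|k IH] f g /=.
  by move=> cf cg x Ux; apply: cvgD; [exact: cf|exact: cg].
move=> [df cf] [dg cg]; split=> [x Ux|v].
  by apply: differentiableD; [exact: df|exact: dg].
apply: (Ck_eq oU) (IH _ _ (cf v) (cg v)) => x Ux /=.
by rewrite deriveD//; apply: diff_derivable; [exact: df|exact: dg].
Qed.

Lemma CkM k f g : Ck k U f -> Ck k U g -> Ck k U (f \* g).
Proof.
elim: k f g => [|k IH] f g /=.
  by move=> cf cg x Ux; apply: cvgM; [exact: cf|exact: cg].
move=> [df cf] [dg cg]; split=> [x Ux|v].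
  by apply: differentiableM; [exact: df|exact: dg].
apply: (@Ck_eq _ _ _ _ ((f \* 'D_v g) \+ (g \* 'D_v f))) => // [x Ux /=|].
  by rewrite deriveM//; apply: diff_derivable; [exact: df|exact: dg].
by apply: CkD; apply: IH => //; apply: CkW; split.
Qed.

Lemma CkV k f : (forall x, U x -> f x != 0) -> Ck k U f -> Ck k U (fun x => (f x)^-1).
Proof.
move=> f0; elim: k => [|k IH] /=.
  by move=> cf x Ux; apply: cvgV; [exact: f0|exact: cf].
move=> [df cf]; split=> [x Ux|v].
  by apply: differentiableV; [exact: df|exact: f0].
have cfV : Ck k U (fun x => (f x)^-1) by apply: IH; apply: CkW; split.
apply: (@Ck_eq _ _ _ _ (cst (-1) \* ('D_v f \* ((fun x => (f x)^-1) \* (fun x => (f x)^-1))))) => // [x Ux /=|].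
  rewrite deriveV//; [|exact: f0|exact/diff_derivable/df].
  by rewrite -[RHS]/(_ * _) mulN1r /GRing.scale/= mulNr -expr2 exprVn mulrC.
by apply: CkM; [exact: Ck_cst|apply: CkM => //; exact: CkM].
Qed.

Lemma Ck_sqrt k f : (forall x, U x -> 0 < f x) -> Ck k U f ->
  Ck k U (fun x => Num.sqrt (f x)).
Proof.
move=> f0.
have dsq x : U x -> differentiable (Num.sqrt : R -> R) (f x).
  by move=> Ux; apply/derivable1_diffP; have := is_derive1_sqrt (f0 _ Ux); case.
elim: k => [|k IH] /=.
  move=> cf x Ux; apply: continuous_comp; [exact: cf|exact: sqrt_continuous].
move=> [df cf]; split=> [x Ux|v].
  by apply: differentiable_comp; [exact: df|exact: dsq].
have cs : Ck k U (fun x => Num.sqrt (f x)) by apply: IH; apply: CkW; split.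
apply: (@Ck_eq _ _ _ _ ((fun x => (2 * Num.sqrt (f x))^-1) \* 'D_v f)) => // [x Ux /=|].
  rewrite [RHS]deriveE; last by apply: differentiable_comp; [exact: df|exact: dsq].
  rewrite (@diff_comp _ _ _ _ f Num.sqrt); [|exact: df|exact: dsq].
  rewrite /= -(deriveE v (df x Ux)).
  rewrite deriv1E; last exact/derivable1_diffP/dsq.
  by rewrite derive1E derive_sqrt ?f0// [LHS]mulrC.
apply: CkM => //; apply: CkV; first by move=> x Ux; rewrite mulf_neq0// sqrtr_eq0 -ltNge f0.
by apply: CkM => //; exact: Ck_cst.
Qed.
End algebra.

End Smooth.

Section Manifold.
Context {R : realType}.

Record chart (M : topologicalType) := Chart {
  chart_dom : set M;
  chart_map :> M -> 'rV[R]_4;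
  chart_inv : 'rV[R]_4 -> M;
  chart_dom_open : open chart_dom;
  chart_img_open : open (chart_map @` chart_dom);
  chart_mapK : {in chart_dom, cancel chart_map chart_inv};
  chart_continuous : {within chart_dom, continuous chart_map};
  chart_inv_continuous : {within chart_map @` chart_dom, continuous chart_inv}
}.

End Manifold.
Arguments chart R M : clear implicits.
Arguments chart_img_open {R M} c.

(* Hausdorff and second countable, of dimension 4. The atlas need not be maximal:
   it only serves to determine the smooth functions. *)
Record manifold4 (R : realType) := Manifold4 {
  mfd_space :> topologicalType;
  atlas : set (chart R mfd_space);
  mfd_hausdorff : hausdorff_space mfd_space;
  mfd_second_countable : @second_countable mfd_space;
  atlas_cover : forall p, exists2 c, atlas c & chart_dom c p;
  atlas_smooth : forall c d, atlas c -> atlas d ->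
    smooth_on (c @` (chart_dom c `&` chart_dom d)) (d \o chart_inv c)
}.

Section SmoothFunctions.
Context {R : realType} (M : manifold4 R).
Implicit Types f g : M -> R.

Definition smooth f : Prop :=
  forall c, atlas c -> smooth_on (c @` chart_dom c) (f \o chart_inv c).

Lemma smooth_cst (a : R) : smooth (fun=> a).
Proof. by move=> c _ k; exact: Ck_cst. Qed.

Lemma smoothD f g : smooth f -> smooth g -> smooth (fun p => f p + g p).
Proof.
by move=> sf sg c cA k; exact: (CkD (chart_img_open c) (sf c cA k) (sg c cA k)).
Qed.

Lemma smoothM f g : smooth f -> smooth g -> smooth (fun p => f p * g p).
Proof.
by move=> sf sg c cA k; exact: (CkM (chart_img_open c) (sf c cA k) (sg c cA k)).
Qed.

Lemma smoothV f : (forall p, f p != 0) -> smooth f -> smooth (fun p => (f p)^-1).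
Proof.
move=> f0 sf c cA k.
by apply: (CkV (chart_img_open c) _ (sf c cA k)) => x _; exact: f0.
Qed.

Lemma smooth_sqrt f : (forall p, 0 < f p) -> smooth f ->
  smooth (fun p => Num.sqrt (f p)).
Proof.
move=> f0 sf c cA k.
by apply: (Ck_sqrt (chart_img_open c) _ (sf c cA k)) => x _; exact: f0.
Qed.

Definition smooth_pred : {pred M -> R} := fun f => `[< smooth f >].

Record smooth_fun := SmoothFun {
  smooth_fun_val :> M -> R;
  _ : smooth_fun_val \in smooth_pred
}.
HB.instance Definition _ := [isSub for smooth_fun_val].
HB.instance Definition _ := [Choice of smooth_fun by <:].

Lemma smooth_subring : subring_closed smooth_pred.
Proof.
split=> [|f g|f g].
- by apply/asboolP; exact: smooth_cst.
- move=> /asboolP sf /asboolP sg; apply/asboolP.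
  rewrite (_ : f - g = fun p => f p + (-1) * g p).
    by apply: smoothD => //; apply: smoothM => //; exact: smooth_cst.
  by apply/funext => p; rewrite mulN1r.
- move=> /asboolP sf /asboolP sg; apply/asboolP; exact: smoothM.
Qed.
HB.instance Definition _ := GRing.isSubringClosed.Build (M -> R) smooth_pred
  smooth_subring.
HB.instance Definition _ := GRing.SubChoice_isSubComPzRing.Build _ _
  smooth_fun (GRing.subringClosedP _).

Lemma smooth_scaler : GRing.scaler_closed smooth_pred.
Proof.
move=> a f /asboolP sf; apply/asboolP.
by apply: smoothM => //; exact: smooth_cst.
Qed.
HB.instance Definition _ := GRing.isScaleClosed.Build R (M -> R) smooth_pred
  smooth_scaler.
HB.instance Definition _ := [SubZmodule_isSubLmodule of smooth_fun by <:].

End SmoothFunctions.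
Arguments smooth {R M} f.

Section Tangent.
Context {R : realType} {M : manifold4 R} (p : M).

(* Tangent vectors at [p] are the derivations at [p] of the algebra of (global)
   smooth functions; covectors are the linear forms on tangent vectors. *)
Definition derivation_at (v : smooth_fun M -> R) : Prop :=
  linear_for *%R v /\ (forall f g, v (f * g) = f p * v g + g p * v f).

Definition derivation_pred : {pred smooth_fun M -> R} :=
  fun v => `[< derivation_at v >].

Record tangent := Tangent {
  tangent_val :> smooth_fun M -> R;
  _ : tangent_val \in derivation_pred
}.
HB.instance Definition _ := [isSub for tangent_val].
HB.instance Definition _ := [Choice of tangent by <:].

Lemma derivation_submod : submod_closed derivation_pred.
Proof.
split=> [|a u v /asboolP[lu du] /asboolP[lv dv]]; apply/asboolP; split.
- by move=> b f g /=; rewrite mulr0 addr0.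
- by move=> f g /=; rewrite !mulr0 addr0.
- move=> b f g; rewrite !fctE lu lv /GRing.scale/=; ring.
- move=> f g; rewrite !fctE du dv /GRing.scale/=; ring.
Qed.
HB.instance Definition _ := GRing.isSubmodClosed.Build R (smooth_fun M -> R)
  derivation_pred derivation_submod.
HB.instance Definition _ := [SubChoice_isSubLmodule of tangent by <:].

Definition linear_form_pred : {pred tangent -> R} :=
  fun w => `[< linear_for *%R w >].

Record cotangent := Cotangent {
  cotangent_val :> tangent -> R;
  _ : cotangent_val \in linear_form_pred
}.
HB.instance Definition _ := [isSub for cotangent_val].
HB.instance Definition _ := [Choice of cotangent by <:].

Lemma linear_form_submod : submod_closed linear_form_pred.
Proof.
split=> [|a u v /asboolP lu /asboolP lv]; apply/asboolP.
- by move=> b f g /=; rewrite mulr0 addr0.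
- move=> b f g; rewrite !fctE lu lv /GRing.scale/=; ring.
Qed.
HB.instance Definition _ := GRing.isSubmodClosed.Build R (tangent -> R)
  linear_form_pred linear_form_submod.
HB.instance Definition _ := [SubChoice_isSubLmodule of cotangent by <:].

End Tangent.

(* Smoothness of tensor fields is tested on smooth functions and smooth vector
   fields; thanks to bump functions this agrees with smoothness of the components
   in charts. *)
Record vector_field (R : realType) (M : manifold4 R) := VectorField {
  vf_val :> forall p : M, tangent p;
  vf_smooth : forall f : smooth_fun M, smooth (fun p => vf_val p f)
}.

Record one_form (R : realType) (M : manifold4 R) := OneForm {
  form_val :> forall p : M, cotangent p;
  form_smooth : forall X : vector_field M, smooth (fun p => form_val p (X p))
}.

(* Signature (+,-,-,-): existence of an orthonormal basis of each tangent space
   with one vector of square 1 and three of square -1 (the coefficients [c] are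
   unique by orthonormality). *)
Record lorentz_metric (R : realType) (M : manifold4 R) := LorentzMetric {
  metric :> forall p : M, tangent p -> tangent p -> R;
  metric_sym : forall p (x y : tangent p), metric x y = metric y x;
  metric_linear : forall p (x : tangent p), linear_for *%R (metric x);
  metric_signature : forall p, exists e : 'I_4 -> tangent p,
    (forall x, exists c : 'I_4 -> R, x = \sum_i c i *: e i) /\
    (forall i j, metric (e i) (e j) =
      if i == j then (if i == 0 then 1 else -1) else 0);
  metric_smooth : forall X Y : vector_field M,
    smooth (fun p => metric (X p) (Y p))
}.

Arguments metric {R M} l p x y.

Definition timelike (R : realType) (M : manifold4 R) (g : lorentz_metric M)
  (V : vector_field M) : Prop := forall p, 0 < g p (V p) (V p).

Record spacetime (R : realType) := Spacetime {
  st_manifold :> manifold4 R;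
  st_metric : lorentz_metric st_manifold;
  st_nonempty : exists p : st_manifold, True;
  st_time_orientable : exists T, timelike st_metric T
}.

Section Cometric.
Context {R : realType} {M : manifold4 R} (g : lorentz_metric M) (p : M).
Implicit Types (x y z : tangent p) (w : cotangent p).

Lemma cotangentP w1 w2 : (forall x, w1 x = w2 x) -> w1 = w2.
Proof. by move=> w12; apply/val_inj/funext. Qed.

Lemma cotangent_linear w : linear_for *%R w.
Proof. by have /asboolP := valP w. Qed.

Lemma cotangentD w x y : w (x + y) = w x + w y.
Proof. by have := cotangent_linear w 1 x y; rewrite scale1r mul1r. Qed.

Lemma cotangent0 w : w 0 = 0.
Proof. by apply: (@addrI _ (w 0)); rewrite -cotangentD !addr0. Qed.

Lemma cotangentZ w a x : w (a *: x) = a * w x.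
Proof. by have := cotangent_linear w a x 0; rewrite !addr0 cotangent0 addr0. Qed.

Lemma cotangent_sum w n (c : 'I_n -> R) (e : 'I_n -> tangent p) :
  w (\sum_i c i *: e i) = \sum_i c i * w (e i).
Proof.
elim/big_ind2: _ => [|x a y b <- <-|i _]; first exact: cotangent0.
- exact: cotangentD.
- exact: cotangentZ.
Qed.

Fact flat_subproof x : g p x \in @linear_form_pred R M p.
Proof. by apply/asboolP; exact: metric_linear. Qed.

Definition flat x : cotangent p := Cotangent (flat_subproof x).

Lemma flat_inj : injective flat.
Proof.
have [e [span orth]] := metric_signature g p.
have coef (c : 'I_4 -> R) j :
    flat (e j) (\sum_i c i *: e i) = c j * (if j == 0 then 1 else -1).
  rewrite cotangent_sum (bigD1 j)//= orth eqxx big1 ?addr0// => i ij.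
  by rewrite orth eq_sym (negbTE ij) mulr0.
move=> x y xy; have [c cx] := span x; have [d dy] := span y.
rewrite cx dy; apply: eq_bigr => j _; congr (_ *: _).
have : flat (e j) x = flat (e j) y.
  by rewrite /= metric_sym [RHS]metric_sym; exact: (congr1 (fun w => w (e j)) xy).
rewrite cx dy !coef; case: ifP => _; first by rewrite !mulr1.
by rewrite !mulrN1 => /oppr_inj.
Qed.

Lemma flat_surj w : exists x, flat x = w.
Proof.
have [e [span orth]] := metric_signature g p.
pose s j : R := if j == 0 :> 'I_4 then 1 else -1.
exists (\sum_j (s j * w (e j)) *: e j); apply: cotangentP => y.
have [c ->] := span y; rewrite !cotangent_sum; apply: eq_bigr => i _.
congr (_ * _); rewrite /= metric_sym.
have /= -> := cotangent_sum (flat (e i)) (fun j => s j * w (e j)) e.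
rewrite (bigD1 i)//= orth eqxx big1 => [|j ji]; last first.
  by rewrite orth eq_sym (negbTE ji) mulr0.
by rewrite addr0 /s; case: ifP => _; ring.
Qed.

(* The default 0 is never used, see [flat_surj]. *)
Definition sharp w : tangent p := xget 0 [set x | flat x = w].

Lemma sharpK w : flat (sharp w) = w.
Proof. rewrite /sharp; case: xgetP => [x _ ->|nx]; [by []|]; by have [x /nx] := flat_surj w. Qed.

Lemma flatK x : sharp (flat x) = x.
Proof. by apply: flat_inj; rewrite sharpK. Qed.

(* The metric induced by [g] on covectors, see [cometric_flat]. *)
Definition cometric w1 w2 : R := g p (sharp w1) (sharp w2).

Lemma cometric_flat x y : cometric (flat x) (flat y) = g p x y.
Proof. by rewrite /cometric !flatK. Qed.

Lemma cometric_flatr w x : cometric w (flat x) = w x.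
Proof. by rewrite /cometric flatK -[in RHS](sharpK w). Qed.
End Cometric.

Record admissible_pair (R : realType) (M : manifold4 R) := AdmissiblePair {
  alpha : smooth_fun M;
  beta : smooth_fun M;
  alpha_gt0 : forall p, 0 < alpha p;
  alphaDbeta_gt0 : forall p, 0 < alpha p + beta p
}.

Lemma smooth_funP (R : realType) (M : manifold4 R) (f : smooth_fun M) : smooth f.
Proof. by have /asboolP := valP f. Qed.

Section Disformal.
Context {R : realType} (M : spacetime R) (V : vector_field M).
Local Notation g := (st_metric M).
Local Notation h := (cometric g).

Section Pointwise.
Context (p : M).
Implicit Types (x y z : tangent p) (w : cotangent p).

Definition par x : tangent p := (g p x (V p) / g p (V p) (V p)) *: V p.
Definition perp x : tangent p := x - par x.

Definition copar w : cotangent p :=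
  (h w (flat g (V p)) / h (flat g (V p)) (flat g (V p))) *: flat g (V p).
Definition coperp w : cotangent p := w - copar w.

Context (ab : admissible_pair M).
Local Notation a := (alpha ab p).
Local Notation b := (beta ab p).

Definition disformal_metric y z : R :=
  a * g p y z + b / g p (V p) (V p) * g p (V p) y * g p (V p) z.

Definition disformal_cometric w1 w2 : R :=
  a^-1 * h w1 w2 - b / (a * (a + b)) *
    (h (flat g (V p)) w1 * h (flat g (V p)) w2 /
     h (flat g (V p)) (flat g (V p))).

Context (eps1 eps2 : R).

Definition disformal_vec x : tangent p :=
  (eps1 * Num.sqrt (a + b)) *: par x + (eps2 * Num.sqrt a) *: perp x.

Definition disformal_covec w : cotangent p :=
  (eps1 / Num.sqrt (a + b)) *: copar w + (eps2 / Num.sqrt a) *: coperp w.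

End Pointwise.

Context (V_timelike : timelike g V) (ab : admissible_pair M) (eps1 eps2 : R).

Let gVV_neq0 p : g p (V p) (V p) != 0.
Proof. by rewrite gt_eqF. Qed.

Let smooth_sqrt_alpha : smooth (fun p => Num.sqrt (alpha ab p)).
Proof. by apply: smooth_sqrt; [exact: alpha_gt0|exact: smooth_funP]. Qed.

Let smooth_sqrt_alphaDbeta : smooth (fun p => Num.sqrt (alpha ab p + beta ab p)).
Proof.
apply: smooth_sqrt; first exact: alphaDbeta_gt0.
by apply: smoothD; exact: smooth_funP.
Qed.

Let smooth_sqrt_alphaV : smooth (fun p => (Num.sqrt (alpha ab p))^-1).
Proof.
by apply: smoothV => // p; rewrite gt_eqF// sqrtr_gt0 alpha_gt0.
Qed.

Let smooth_sqrt_alphaDbetaV :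
  smooth (fun p => (Num.sqrt (alpha ab p + beta ab p))^-1).
Proof.
by apply: smoothV => // p; rewrite gt_eqF// sqrtr_gt0 alphaDbeta_gt0.
Qed.

Let smooth_ratio (f : M -> R) :
  smooth f -> smooth (fun p => f p / g p (V p) (V p)).
Proof.
by move=> sf; apply: smoothM => //; apply: smoothV => //; exact: metric_smooth.
Qed.

Let smooth_combination (s t q u v : M -> R) :
  smooth s -> smooth t -> smooth q -> smooth u -> smooth v ->
  smooth (fun p => eps1 * s p * (q p * v p) + eps2 * t p * (u p + -1 * (q p * v p))).
Proof.
by move=> ss st sq su sv; do ![apply: smoothD|apply: smoothM]; 
  try exact: smooth_cst.
Qed.

Fact disformal_vector_field_smooth (X : vector_field M) (f : smooth_fun M) :
  smooth (fun p => disformal_vec ab eps1 eps2 (X p) f).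
Proof.
have := smooth_combination smooth_sqrt_alphaDbeta smooth_sqrt_alpha
  (smooth_ratio (metric_smooth g X V)) (vf_smooth X f) (vf_smooth V f).
by congr smooth; apply/funext => p; rewrite mulN1r.
Qed.

Definition disformal_field (X : vector_field M) : vector_field M :=
  VectorField (disformal_vector_field_smooth X).

Fact disformal_one_form_smooth (w : one_form M) (X : vector_field M) :
  smooth (fun p => disformal_covec ab eps1 eps2 (w p) (X p)).
Proof.
have := smooth_combination smooth_sqrt_alphaDbetaV smooth_sqrt_alphaV
  (smooth_ratio (form_smooth w V)) (form_smooth w X) (metric_smooth g V X).
congr smooth; apply/funext => p.
by rewrite mulN1r -(cometric_flat g (V p)) -(cometric_flatr g (w p)).
Qed.

Definition disformal_one_form (w : one_form M) : one_form M :=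
  OneForm (disformal_one_form_smooth w).

End Disformal.

(* Associativity is automatic for composition. *)
Definition abelian_group_of_maps (T : Type) (F : set (T -> T)) : Prop :=
  [/\ forall f1 f2, F f1 -> F f2 -> F (f1 \o f2),
      forall f1 f2, F f1 -> F f2 -> f1 \o f2 = f2 \o f1 &
      exists e, [/\ F e,
        forall f, F f -> e \o f = f /\ f \o e = f &
        forall f, F f -> exists2 f', F f' & f' \o f = e /\ f \o f' = e]].

(* Main.v *)
Require Import Defs.
From mathcomp Require Import all_boot all_order all_algebra.
From mathcomp Require Import all_classical all_reals all_analysis.
From mathcomp Require Import ring lra.
Import Order.TTheory GRing.Theory Num.Theory.
Import numFieldNormedType.Exports.
Local Open Scope classical_set_scope.
Local Open Scope ring_scope.

(* Pointwise, each map is [s P + t (1 - P)] for the projector [P] onto the line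
   of [V]; such maps compose by multiplying the coefficients, so for the signs
   (+1,+1) the maps form a homomorphic image of the group of pairs of positive
   functions [(alpha + beta, alpha)] under pointwise product. For other signs,
   squaring the map of the pair (1, 0) makes a negative coefficient positive,
   which contradicts closure as soon as [P] and [1 - P] are nonzero on some
   field. For [1 - P] this requires a global vector field that is not
   everywhere parallel to [V]: coordinate fields cut off by a smooth bump function,
   extended by zero outside a chart, provide one, and the differential of a
   suitable smooth function does the same for 1-forms. *)

Set Implicit Arguments.
Unset Strict Implicit.
Unset Printing Implicit Defensive.

(** * A smooth function vanishing on the negative half-line *)

Section FlatFunction.
Context {R : realType}.
Implicit Types x t : R.

(* The exponent makes the family closed under differentiation, up to linear
   combinations. *)
Definition flat_fun (n : nat) x : R :=
  if 0 < x then x ^- n * expR (- x^-1) else 0.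

Lemma flat_fun_gt0 n x : 0 < x -> 0 < flat_fun n x.
Proof. by move=> x0; rewrite /flat_fun x0 mulr_gt0 ?expR_gt0// invr_gt0 exprn_gt0. Qed.

Lemma flat_fun_le0 n x : x <= 0 -> flat_fun n x = 0.
Proof. by rewrite /flat_fun leNgt => /negbTE->. Qed.

Lemma flat_funS n x : flat_fun n x = x * flat_fun n.+1 x.
Proof.
rewrite /flat_fun; case: ifPn => [x0|_]; last by rewrite mulr0.
by rewrite exprS invfM !mulrA divff ?mul1r// gt_eqF.
Qed.

Lemma flat_fun_bound n x : `|flat_fun n x| <= n.+1`!%:R * `|x|.
Proof.
have [x0|x0] := leP x 0; first by rewrite flat_fun_le0// normr0 mulr_ge0.
have y0 : 0 < x^-1 by rewrite invr_gt0.
rewrite !gtr0_norm ?flat_fun_gt0// /flat_fun x0 expRN ler_pdivrMr ?expR_gt0//.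
apply: (@le_trans _ _ (n.+1`!%:R * x * (x^-1 ^+ n.+1 / n.+1`!%:R))); last first.
  rewrite ler_pM2l ?mulr_gt0 ?ltr0n ?fact_gt0//.
  by apply: le_trans (expR_ge1Dxn n (ltW y0)); rewrite lerDr.
have fn0 : n.+1`!%:R != 0 :> R by rewrite pnatr_eq0 -lt0n fact_gt0.
rewrite le_eqVlt; apply/orP; left; apply/eqP.
rewrite -exprVn exprS; set u := n.+1`!%:R in fn0 *; set v := x^-1 ^+ n.
by field; rewrite fn0 gt_eqF.
Qed.

Lemma is_derive_flat_fun n x :
  is_derive x 1 (flat_fun n) (flat_fun n.+2 x - n%:R * flat_fun n.+1 x).
Proof.
have [x0|x0|->] := ltgtP x 0.
- rewrite !flat_fun_le0 ?(ltW x0)// mulr0 subr0.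
  apply: (@near_eq_is_derive _ _ _ (cst 0)).
  by near=> y; rewrite flat_fun_le0//; apply: ltW; near: y; exact: lt_nbhsl.
- apply: (@near_eq_is_derive _ _ _
    ((fun y : R => y^-1 ^+ n) \* (expR \o (fun y => - y^-1)))).
    near=> y; have y0 : 0 < y by near: y; exact: lt_nbhsr.
    by rewrite /flat_fun y0/= exprVn.
  have dV : is_derive x 1 (fun y : R => y^-1) (- x ^- 2 *: 1).
    by apply: (@is_deriveV R id); rewrite gt_eqF.
  have dN : is_derive x 1 (fun y : R => - y^-1) (- (- x ^- 2 *: 1)).
    exact: is_deriveN.
  have dE := is_derive1_comp (is_derive_expR _) dN.
  have dX : is_derive x 1 (fun y : R => y^-1 ^+ n)
      ((n%:R * x^-1 ^+ n.-1) *: (- x ^- 2 *: 1)).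
    by have := is_deriveX n dV; rewrite exprfctE.
  apply: is_derive_eq; rewrite /flat_fun x0 /= /GRing.scale/=.
  (* The split on [n] resolves the exponent [n.-1] left by differentiating the power. *)
  clear dE dX; rewrite -!exprVn; case: n => [|n]; rewrite ?exprS; ring.
- rewrite !flat_fun_le0// mulr0 subr0.
  have cvg0 :
      (fun h => h^-1 *: (flat_fun n (h *: (1 : R) + 0) - flat_fun n 0)) @ 0^' --> (0 : R).
    apply/cvgr0Pnorm_le => e e0; near=> h.
    have h0 : h != 0 by near: h; exact: nbhs_dnbhs_neq.
    (* By [flat_funS] the difference quotient at 0 is [flat_fun n.+1 h], which the bound sends to
       0. *)
    rewrite addr0 [h *: _]mulr1 [flat_fun n 0]flat_fun_le0// subr0 flat_funS.
    rewrite [_ *: _]mulKf//; apply: le_trans (flat_fun_bound _ _) _.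
    have F0 : 0 < n.+2`!%:R :> R by rewrite ltr0n fact_gt0.
    rewrite mulrC -ler_pdivlMr//; near: h.
    by apply: dnbhs0_le; rewrite divr_gt0.
  apply: DeriveDef; first by apply/cvg_ex; exists 0.
  exact: cvg_lim cvg0.
Unshelve. all: by end_near. Qed.
End FlatFunction.

(** * Functions of class C^k *)

Section CkTheory.
Context {R : realType}.
Implicit Types V W : normedModType R.

(** Each clause of [Ck] is a condition at one point, so the witnessing set may vary with the
    point. *)
Lemma Ck_local V W k (U : set V) (f : V -> W) :
  (forall x, U x -> exists2 U', U' x & Ck k U' f) -> Ck k U f.
Proof.
elim: k f => [|k IH] f Uf /=.
  by move=> x /Uf[U' U'x cf]; exact: cf.
split=> [x /Uf[U' U'x [df _]]|v]; first exact: df.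
by apply: IH => x /Uf[U' U'x [_ cf]]; exists U' => //; exact: cf.
Qed.

Lemma Ck_subset V W k (U U' : set V) (f : V -> W) :
  U `<=` U' -> Ck k U' f -> Ck k U f.
Proof. by move=> UU' cf; apply: Ck_local => x /UU' U'x; exists U'. Qed.

Lemma Ck_sum V k (U : set V) n (f : 'I_n -> V -> R) : open U ->
  (forall i, Ck k U (f i)) -> Ck k U (fun x => \sum_i f i x).
Proof.
move=> oU cf; rewrite (_ : (fun _ => _) = \sum_i f i); last first.
  by apply/funext => x; rewrite fct_sumE.
by elim/big_ind: _ => [|g h cg ch|i _]; [exact: Ck_cst|exact: CkD|exact: cf].
Qed.

Lemma derive_coord V n (G : V -> 'rV[R]_n.+1) i x v : differentiable G x ->
  'D_v (fun y => G y ord0 i) x = 'D_v G x ord0 i.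
Proof.
by move=> dG; rewrite derive_mx ?mxE//; exact: diff_derivable.
Qed.

Lemma differentiable_comp_coord V n (G : V -> 'rV[R]_n.+1) i x :
  differentiable G x -> differentiable (fun y => G y ord0 i) x.
Proof.
move=> dG; apply: (@differentiable_comp _ _ _ _ G
  (fun A : 'rV[R]_n.+1 => A ord0 i)) => //.
exact: differentiable_coord.
Qed.

Lemma Ck_coord V n k (U : set V) (G : V -> 'rV[R]_n.+1) i : open U ->
  Ck k U G -> Ck k U (fun x => G x ord0 i).
Proof.
move=> oU; elim: k G => [|k IH] G /=.
  move=> cG x Ux.
  apply: (@continuous_comp _ _ _ G (fun A : 'rV[R]_n.+1 => A ord0 i)).
    exact: cG.
  exact: coord_continuous.
move=> [dG cG]; split=> [x Ux|v].
  by apply: differentiable_comp_coord; exact: dG.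
by apply: (Ck_eq oU) (IH _ (cG v)) => x Ux; rewrite derive_coord//; exact: dG.
Qed.

Lemma derive_comp V n (F : 'rV[R]_n.+1 -> R) (G : V -> 'rV[R]_n.+1) x v :
  differentiable G x -> differentiable F (G x) ->
  'D_v (F \o G) x =
  \sum_i 'D_v G x ord0 i * 'D_(delta_mx ord0 i) F (G x).
Proof.
move=> dG dF; rewrite deriveE; last exact: differentiable_comp.
rewrite diff_comp//= -(deriveE v dG) [in LHS](row_sum_delta ('D_v G x)).
rewrite linear_sum; apply: eq_bigr => i _.
by rewrite linearZ (deriveE _ dF).
Qed.

(** Induction on [k] for all [F] at once: by the chain rule, the derivative is a sum of products
    involving the partial derivatives of [F] composed with [G]. *)
Lemma Ck_comp V n k (U : set V) (U' : set 'rV[R]_n.+1) (F : 'rV[R]_n.+1 -> R)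
    (G : V -> 'rV[R]_n.+1) : open U -> (forall x, U x -> U' (G x)) ->
  Ck k U G -> Ck k U' F -> Ck k U (F \o G).
Proof.
move=> oU UG; elim: k F => [|k IH] F.
  move=> cG cF x Ux; apply: continuous_comp; [exact: cG|apply: cF; exact: UG].
move=> cG1 [dF cF]; have cG := CkW cG1; move: cG1 => [dG cdG].
split=> [x Ux|v].
  by apply: differentiable_comp; [exact: dG|apply: dF; exact: UG].
apply: (@Ck_eq _ _ _ _ _
  (fun x => \sum_i 'D_v G x ord0 i * 'D_(delta_mx ord0 i) F (G x))) => // [x Ux|].
  by rewrite derive_comp//; [exact: dG|apply: dF; exact: UG].
apply: Ck_sum => // i; apply: CkM => //.
  exact: (Ck_coord i oU (cdG v)).
exact: (IH ('D_(delta_mx ord0 i) F) cG (cF _)).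
Qed.

(** The induction on [k] ranges over all [n], since each derivative raises the exponent. *)
Lemma Ck_flat_fun V n k (U : set V) (G : V -> R) : open U ->
  Ck k U G -> Ck k U (flat_fun n \o G).
Proof.
move=> oU.
have dF m y : differentiable (flat_fun m : R -> R) y.
  by apply/derivable1_diffP; case: (is_derive_flat_fun m y).
elim: k n => [|k IH] n.
  move=> cG x Ux; apply: continuous_comp; first exact: cG.
  exact/differentiable_continuous.
move=> cG1; have cG := CkW cG1; move: cG1 => [dG cdG].
split=> [x Ux|v]; first by apply: differentiable_comp; [exact: dG|].
apply: (@Ck_eq _ _ _ _ _ ('D_v G \* ((flat_fun n.+2 \o G) \+
    (cst (- n%:R) \* (flat_fun n.+1 \o G))))) => // [x Ux|].
  rewrite deriveE; last by apply: differentiable_comp; [exact: dG|].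
  rewrite (@diff_comp _ _ _ _ G (flat_fun n)) => [|//|]; [|exact: dG|exact: dF].
  rewrite /= -(deriveE v (dG x Ux)) deriv1E; last exact/derivable1_diffP.
  by rewrite derive1E (@derive_val _ _ _ _ _ _ _ (is_derive_flat_fun _ _)) mulNr.
apply: CkM => //; first exact: cdG.
apply: CkD => //; first exact: IH.
by apply: CkM => //; [exact: Ck_cst|exact: IH].
Qed.

Lemma Ck_coordinate n k (U : set 'rV[R]_n.+1) (a : R) i :
  Ck k U (fun x : 'rV[R]_n.+1 => x ord0 i - a).
Proof.
(* Passing to the whole space provides the open set that [Ck_eq] asks for. *)
apply: (@Ck_subset _ _ _ _ setT) => //.
have dc (x : 'rV[R]_n.+1) : differentiable (fun x : 'rV[R]_n.+1 => x ord0 i - a) x.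
  by apply: differentiableB => //; exact: differentiable_coord.
case: k => [|k].
  by move=> x _; exact/differentiable_continuous.
split=> [//|v].
apply: (@Ck_eq _ _ _ _ _ (cst (v ord0 i))); [exact: openT| |exact: Ck_cst].
move=> x _.
rewrite deriveB//; try exact/diff_derivable/differentiable_coord.
by rewrite derive_cst subr0 (@derive_coord _ _ id)// derive_id.
Qed.

End CkTheory.

(** * Cut-off functions and coordinate fields *)

Section ChartExtension.
Context {R : realType} {M : manifold4 R}.
Implicit Types (c d : chart R M) (H : 'rV[R]_4 -> R).

Definition chart_ext c H (q : M) : R := if `[< chart_dom c q >] then H (c q) else 0.

Lemma chart_extE c H q : chart_dom c q -> chart_ext c H q = H (c q).
Proof. by rewrite /chart_ext => cq; case: asboolP. Qed.

Lemma chart_ext_out c H q : ~ chart_dom c q -> chart_ext c H q = 0.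
Proof. by rewrite /chart_ext => cq; case: asboolP. Qed.

Lemma chart_invK c q : chart_dom c q -> chart_inv c (c q) = q.
Proof. by move=> cq; apply: chart_mapK; exact/mem_set. Qed.

(** The image is the trace of a preimage under [chart_inv], which is continuous on the open image of
    the chart. *)
Lemma open_chart_image c (W : set M) :
  open W -> open (c @` (chart_dom c `&` W)).
Proof.
move=> oW; have oc := chart_img_open c.
rewrite (_ : _ @` _ = c @` chart_dom c `&` chart_inv c @^-1` W).
  move: W oW; apply/(continuous_inP _ oc).
  by rewrite -continuous_open_subspace//; exact: chart_inv_continuous.
apply/seteqP; split=> [_ [q [cq Wq] <-]|_ [[q cq <-]]] /=; rewrite chart_invK//.
  by split=> //; exists q.
by move=> Wq; exists q.
Qed.

Lemma smooth_chart_ext c H (K : set 'rV[R]_4) : atlas c ->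
  compact K -> K `<=` c @` chart_dom c -> (forall x, ~ K x -> H x = 0) ->
  smooth_on (c @` chart_dom c) H -> smooth (chart_ext c H).
Proof.
move=> cA cK Kc HK sH d dA k.
pose K' := chart_inv c @` K.
have clK' : closed K'.
  apply: compact_closed; first exact: mfd_hausdorff.
  apply: continuous_compact => //.
  exact: continuous_subspaceW Kc (@chart_inv_continuous _ _ c).
apply: Ck_local => _ [q dq <-].
have [cq|ncq] := pselect (chart_dom c q).
  (* On the overlap, the extension read in [d] is [H] after the transition map. *)
  exists (d @` (chart_dom d `&` chart_dom c)); first by exists q.
  have oU := @open_chart_image d _ (@chart_dom_open _ _ c).
  apply: (@Ck_eq _ _ _ _ _ (H \o (c \o chart_inv d))) => //.
    by move=> _ [q' [dq' cq'] <-] /=; rewrite chart_invK// chart_extE.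
  apply: (@Ck_comp _ _ _ _ _ (c @` chart_dom c)) => //.
  - by move=> _ [q' [dq' cq'] <-] /=; rewrite chart_invK//; exists q'.
  - exact: atlas_smooth.
exists (d @` (chart_dom d `&` ~` K')).
  exists q => //; split=> // -[x /Kc[q' cq' <-]].
  by rewrite chart_invK// => q'q; apply: ncq; rewrite -q'q.
apply: (@Ck_eq _ _ _ _ _ (cst 0)); last exact: Ck_cst.
  by apply: open_chart_image; rewrite openC.
move=> _ [q' [dq' nKq'] <-] /=; rewrite chart_invK//.
have [cq'|ncq'] := pselect (chart_dom c q'); last by rewrite chart_ext_out.
rewrite chart_extE// HK// => Kcq'.
by apply: nKq'; exists (c q') => //; rewrite chart_invK.
Qed.

End ChartExtension.

Section Bump.
Context {R : realType} (n : nat) (a : 'rV[R]_n.+1) (r : R).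
Implicit Types x : 'rV[R]_n.+1.

(** The squared Euclidean distance is polynomial, whereas the norm of row vectors is the maximum
    norm, which is not smooth. *)
Definition bump x : R :=
  flat_fun 0 (r ^+ 2 - \sum_i (x ord0 i - a ord0 i) * (x ord0 i - a ord0 i)).

Lemma bump_center_gt0 : 0 < r -> 0 < bump a.
Proof.
move=> r0; apply: flat_fun_gt0; rewrite big1 ?subr0 ?exprn_gt0// => i _.
by rewrite subrr mulr0.
Qed.

(** Where the bump is nonzero, the sum of squares is below [r ^+ 2], hence so is each square: the
    Euclidean ball lies in the ball of the maximum norm. *)
Lemma bump_out x : 0 < r -> ~ `|a - x| <= r -> bump x = 0.
Proof.
move=> r0 xar; apply: flat_fun_le0; rewrite leNgt; apply/negP => xr; apply: xar.
rewrite distrC [leLHS]mx_normrE; apply: bigmax_le => [|[i j] _]; first exact: ltW.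
rewrite /= !mxE ord1 -(ler_pXn2r (ltn0Sn 1)) ?nnegrE ?(ltW r0)//.
rewrite real_normK ?num_real//; move: xr; rewrite subr_gt0 => /ltW; apply: le_trans.
by rewrite (bigD1 j)//= -expr2 lerDl sumr_ge0// => l _; rewrite -expr2 sqr_ge0.

Qed.

Lemma smooth_bump (U : set 'rV[R]_n.+1) : smooth_on U bump.
Proof.
move=> k; apply: (@Ck_subset _ _ _ _ _ setT) => //.
apply: Ck_flat_fun; first exact: openT.
apply: (@Ck_eq _ _ _ _ _ (cst (r ^+ 2) \+ (cst (-1) \*
   (fun x => \sum_i (x ord0 i - a ord0 i) * (x ord0 i - a ord0 i))))).
- exact: openT.
- by move=> x _ /=; rewrite mulN1r.
apply: CkD; [exact: openT|exact: Ck_cst|].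
apply: CkM; [exact: openT|exact: Ck_cst|].
apply: Ck_sum => [|i]; first exact: openT.
by apply: CkM; [exact: openT|exact: Ck_coordinate|exact: Ck_coordinate].
Qed.

End Bump.

Lemma compact_closed_ball_ {R : realType} n (a : 'rV[R]_n) (r : R) :
  compact (closed_ball_ Num.norm a r).
Proof.
apply: bounded_closed_compact; last exact: closed_closed_ball_.
exists (`|a| + r); split; first exact: num_real.
move=> z az y /= ay; apply: le_trans (ltW az).
by rewrite -[y in leLHS](subKr a) (le_trans (ler_normB _ _))// lerD2l.
Qed.

Section CoordinateFields.
Context {R : realType} {M : manifold4 R}.
Implicit Types (c : chart R M) (p q : M).

Lemma exists_chart_bump c p : chart_dom c p ->
  exists psi : 'rV[R]_4 -> R, exists2 K : set 'rV[R]_4,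
    compact K /\ K `<=` c @` chart_dom c &
    [/\ forall x, ~ K x -> psi x = 0, forall U, smooth_on U psi & psi (c p) = 1].
Proof.
move=> cp.
have /nbhs_closedballP[r rO] : nbhs (c p) (c @` chart_dom c).
  by apply: open_nbhs_nbhs; split; [exact: chart_img_open|exists p].
have r0 : 0 < r%:num by [].
exists (cst (bump (c p) r%:num (c p))^-1 \* bump (c p) r%:num),
  (closed_ball_ Num.norm (c p) r%:num).
  by split; [exact: compact_closed_ball_|rewrite -closed_ballE].
split=> [x xr|U k|/=].
- by rewrite /= (bump_out r0 xr) mulr0.
- apply: (@Ck_subset _ _ _ _ _ setT) => //.
  by apply: CkM; [exact: openT|exact: Ck_cst|exact: smooth_bump].
- by rewrite mulVf// gt_eqF// bump_center_gt0.
Qed.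

Lemma smooth_fun_differentiable c (f : smooth_fun M) q :
  atlas c -> chart_dom c q -> differentiable (f \o chart_inv c) (c q).
Proof.
by move=> cA cq; have [+ _] := smooth_funP f cA 1; apply; exists q.
Qed.

(** The factor [psi] is there to make the extension by zero smooth across the boundary of the
    chart. *)
Definition coord_deriv c (psi : 'rV[R]_4 -> R) v q (f : smooth_fun M) : R :=
  chart_ext c (fun x => psi x * 'D_v (f \o chart_inv c) x) q.

Lemma coord_deriv_derivation c psi v q : atlas c ->
  derivation_at q (coord_deriv c psi v q).
Proof.
move=> cA; have [cq|ncq] := pselect (chart_dom c q); last first.
  by split=> [a f g|f g]; rewrite /coord_deriv !chart_ext_out// !mulr0 addr0.
have df (f : smooth_fun M) : derivable (f \o chart_inv c) (c q) v.
  exact/diff_derivable/smooth_fun_differentiable.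
split=> [a f g|f g]; rewrite /coord_deriv !chart_extE//.
  rewrite (_ : _ \o _ = a *: (f \o chart_inv c) + (g \o chart_inv c))//.
  by rewrite deriveD ?deriveZ//; [rewrite /GRing.scale/=; ring|exact: derivableZ].
rewrite (_ : _ \o _ = (f \o chart_inv c) * (g \o chart_inv c))// deriveM//.
by rewrite /= !chart_invK// /GRing.scale/=; ring.
Qed.

(** The fields are [psi] times the partial derivatives and the functions are [psi] times the
    coordinates centred at [p]. At [p], [psi] is 1 and the centred coordinates vanish, so the
    derivative of [psi] drops out of the product rule. *)
Lemma exists_coordinate_fields p :
  exists (X : 'I_4 -> vector_field M) (f : 'I_4 -> smooth_fun M),
    forall i j, X i p (f j) = (i == j)%:R.
Proof.
have [c cA cp] := atlas_cover p.
have [psi [K [cK Kc] [psiK psi_smooth psi1]]] := exists_chart_bump cp.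
have ext_smooth G : smooth_on (c @` chart_dom c) G ->
    smooth (chart_ext c (psi \* G)).
  move=> sG; apply: (smooth_chart_ext cA cK Kc) => [x /psiK /= ->|k].
    by rewrite mul0r.
  by apply: CkM; [exact: chart_img_open|exact: psi_smooth|exact: sG].
pose coord (i : 'I_4) (x : 'rV[R]_4) := x ord0 i - c p ord0 i.
have f_smooth i : chart_ext c (psi \* coord i) \in @smooth_pred R M.
  by apply/asboolP/ext_smooth => k; exact: Ck_coordinate.
have X_derivation i q : coord_deriv c psi (delta_mx ord0 i) q \in @derivation_pred R M q.
  by apply/asboolP/coord_deriv_derivation.
have X_smooth i (f : smooth_fun M) :
    smooth (fun q => Tangent (X_derivation i q) f).
  apply: (ext_smooth ('D_(delta_mx ord0 i) (f \o chart_inv c))) => k.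
  by have [_] := smooth_funP f cA k.+1; apply.
exists (fun i => VectorField (X_smooth i)), (fun j => SmoothFun (f_smooth j)) => i j /=.
rewrite /coord_deriv chart_extE// psi1 mul1r.
rewrite (@near_eq_derive _ _ _ _ (psi \* coord j)); last first.
  have : nbhs (c p) (c @` chart_dom c).
    by apply: open_nbhs_nbhs; split; [exact: chart_img_open|exists p].
  by apply: filterS => _ [q cq <-] /=; rewrite chart_invK// chart_extE.
have [dpsi _] := psi_smooth setT 1.
(* The 3 stands for row vectors of length 4, written ['rV_n.+1]; order 1 yields
   differentiability. *)
have [dcoord _] := @Ck_coordinate R 3 1 setT (c p ord0 j) j.
rewrite deriveM; [|exact/diff_derivable/dpsi|exact/diff_derivable/dcoord].
rewrite psi1 /coord subrr scale0r addr0 scale1r.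
rewrite deriveB//; try exact/diff_derivable/differentiable_coord.
rewrite derive_cst subr0 (@derive_coord _ _ _ id)// derive_id mxE.
by rewrite eq_sym.
Qed.

End CoordinateFields.

(** * Combinations of a projector and its complement *)

Section Combination.
Context {R : realType} {U : lmodType R} (P : U -> U).
Hypothesis P_linear : linear P.
Hypothesis P_idem : forall x, P (P x) = P x.

Definition combination (s t : R) x : U := s *: P x + t *: (x - P x).

Let P0 : P 0 = 0.
Proof. by apply: (@addrI _ (P 0)); have := P_linear 1 0 0; rewrite !scale1r !addr0. Qed.

Let PZ a x : P (a *: x) = a *: P x.
Proof. by have := P_linear a x 0; rewrite P0 !addr0. Qed.

Let PD x y : P (x + y) = P x + P y.
Proof. by have := P_linear 1 x y; rewrite !scale1r. Qed.

Let PB x y : P (x - y) = P x - P y.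
Proof. by rewrite -scaleN1r PD PZ scaleN1r. Qed.

Lemma combination11 x : combination 1 1 x = x.
Proof. by rewrite /combination !scale1r subrKC. Qed.

Lemma combination_proj s t x : P (combination s t x) = s *: P x.
Proof. by rewrite /combination PD !PZ PB !P_idem subrr scaler0 addr0. Qed.

Lemma combination_coproj s t x :
  combination s t x - P (combination s t x) = t *: (x - P x).
Proof. by rewrite combination_proj /combination addrC addKr. Qed.

(** The map acts as the scalar [s] on the image of [P] and as [t] on its kernel. *)
Lemma combination_comp s t s' t' x :
  combination s t (combination s' t' x) = combination (s * s') (t * t') x.
Proof.
by rewrite {1}/combination combination_coproj combination_proj !scalerA.
Qed.

(** A single vector outside the kernel of [P] detects the first coefficient; [combination_injr] does
    the same for the second, with a vector not fixed by [P]. *)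
Lemma combination_injl s t s' t' x : P x != 0 ->
  combination s t x = combination s' t' x -> s = s'.
Proof.
move=> Px /(congr1 P); rewrite !combination_proj => /eqP.
by rewrite -subr_eq0 -scalerBl scaler_eq0 (negbTE Px) orbF subr_eq0 => /eqP.
Qed.

Lemma combination_injr s t s' t' x : x - P x != 0 ->
  combination s t x = combination s' t' x -> t = t'.
Proof.
move=> Px /(congr1 (fun y => y - P y)); rewrite !combination_coproj => /eqP.
by rewrite -subr_eq0 -scalerBl scaler_eq0 (negbTE Px) orbF subr_eq0 => /eqP.
Qed.

End Combination.

(** * The group structure on admissible pairs *)

Section AdmissiblePairs.
Context {R : realType} {M : manifold4 R}.
Implicit Types ab : admissible_pair M.

Fact unit_pair_gt0 (p : M) : 0 < (1 : smooth_fun M) p + (0 : smooth_fun M) p.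
Proof. by rewrite addr0. Qed.

Definition unit_pair : admissible_pair M :=
  @AdmissiblePair _ _ 1 0 (fun=> ltr01) unit_pair_gt0.

Fact mul_pair_alpha_gt0 ab ab' p : 0 < (alpha ab * alpha ab') p.
Proof. exact: mulr_gt0 (alpha_gt0 ab p) (alpha_gt0 ab' p). Qed.

Let mul_pair_sum ab ab' p : (alpha ab * alpha ab') p +
  ((alpha ab + beta ab) * (alpha ab' + beta ab') - alpha ab * alpha ab') p =
  (alpha ab p + beta ab p) * (alpha ab' p + beta ab' p).
Proof. exact: subrKC. Qed.

Fact mul_pair_sum_gt0 ab ab' p : 0 < (alpha ab * alpha ab') p +
  ((alpha ab + beta ab) * (alpha ab' + beta ab') - alpha ab * alpha ab') p.
Proof. by rewrite mul_pair_sum mulr_gt0 ?alphaDbeta_gt0. Qed.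

(** The type of [mul_pair_sum_gt0] fixes the [beta] of the product, chosen so that [alpha] and
    [alpha + beta] are both multiplicative. [inv_pair] follows the same pattern. *)
Definition mul_pair ab ab' : admissible_pair M :=
  AdmissiblePair (mul_pair_alpha_gt0 ab ab') (mul_pair_sum_gt0 ab ab').

Lemma mul_pair_alphaDbeta ab ab' p :
  alpha (mul_pair ab ab') p + beta (mul_pair ab ab') p =
  (alpha ab p + beta ab p) * (alpha ab' p + beta ab' p).
Proof. exact: mul_pair_sum. Qed.

Fact smooth_inv_proof (f : smooth_fun M) :
  (forall p, 0 < f p) -> (fun p => (f p)^-1) \in @smooth_pred R M.
Proof.
move=> f0; apply/asboolP/smoothV; last exact: smooth_funP.
by move=> p; rewrite gt_eqF.
Qed.

Definition inv_alpha ab := SmoothFun (smooth_inv_proof (alpha_gt0 ab)).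
Definition inv_alphaDbeta ab :=
  SmoothFun (@smooth_inv_proof (alpha ab + beta ab) (alphaDbeta_gt0 ab)).

Fact inv_pair_alpha_gt0 ab p : 0 < inv_alpha ab p.
Proof. by rewrite invr_gt0 alpha_gt0. Qed.

Let inv_pair_sum ab p : inv_alpha ab p + (inv_alphaDbeta ab - inv_alpha ab) p =
  (alpha ab p + beta ab p)^-1.
Proof. exact: subrKC. Qed.

Fact inv_pair_sum_gt0 ab p :
  0 < inv_alpha ab p + (inv_alphaDbeta ab - inv_alpha ab) p.
Proof. by rewrite inv_pair_sum invr_gt0 alphaDbeta_gt0. Qed.

Definition inv_pair ab : admissible_pair M :=
  AdmissiblePair (inv_pair_alpha_gt0 ab) (inv_pair_sum_gt0 ab).

Lemma inv_pair_alphaDbeta ab p :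
  alpha (inv_pair ab) p + beta (inv_pair ab) p = (alpha ab p + beta ab p)^-1.
Proof. exact: inv_pair_sum. Qed.

End AdmissiblePairs.

(** * The group argument, for vector fields and 1-forms at once *)

Section DisformalGroup.
Context {R : realType} {M : manifold4 R} (F : Type) (U : M -> lmodType R).
(** [F] is the type of fields and [P] the projector onto the line of [V] or of its dual form. [phi]
    is the square root for vector fields and its inverse for 1-forms. *)
Context (val : F -> forall p, U p) (P : forall p, U p -> U p) (phi : R -> R).
Context (D : admissible_pair M -> R -> R -> F -> F).
Implicit Types ab : admissible_pair M.
Hypothesis val_ext : forall X Y, (forall p, val X p = val Y p) -> X = Y.
Hypothesis P_linear : forall p, linear (@P p).
Hypothesis P_idem : forall p x, P (P x) = P x :> U p.
Hypothesis phi_gt0 : forall x, 0 < x -> 0 < phi x.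
Hypothesis phi1 : phi 1 = 1.
Hypothesis phiM : forall x y, 0 < x -> 0 < y -> phi (x * y) = phi x * phi y.
Hypothesis DE : forall ab eps1 eps2 X p, val (D ab eps1 eps2 X) p =
  combination (@P p) (eps1 * phi (alpha ab p + beta ab p))
    (eps2 * phi (alpha ab p)) (val X p).

Let D1M ab ab' : D ab 1 1 \o D ab' 1 1 = D (mul_pair ab ab') 1 1.
Proof.
apply/funext => X; apply: val_ext => p; rewrite /= !DE combination_comp//.
rewrite mul_pair_alphaDbeta !mul1r !phiM ?alphaDbeta_gt0//; exact: alpha_gt0.
Qed.

Let D1_unit : D unit_pair 1 1 = id.
Proof.
apply/funext => X; apply: val_ext => p.
by rewrite DE /= addr0 phi1 mulr1 combination11.
Qed.

(** This reduces equality of maps to values of [alpha] and [alpha + beta], without comparing pairs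
    as records. *)
Let D1_ext ab ab' : (forall p, alpha ab p = alpha ab' p) ->
  (forall p, alpha ab p + beta ab p = alpha ab' p + beta ab' p) ->
  D ab 1 1 = D ab' 1 1.
Proof.
move=> aa bb; apply/funext => X; apply: val_ext => p.
by rewrite !DE bb aa.
Qed.

Let D1MC ab ab' : D ab 1 1 \o D ab' 1 1 = D ab' 1 1 \o D ab 1 1.
Proof.
rewrite !D1M; apply: D1_ext => p; first exact: mulrC.
by rewrite !mul_pair_alphaDbeta mulrC.
Qed.

Let D1V ab : D (inv_pair ab) 1 1 \o D ab 1 1 = id.
Proof.
rewrite D1M -D1_unit; apply: D1_ext => p.
  by apply: mulVf; rewrite gt_eqF// alpha_gt0.
rewrite mul_pair_alphaDbeta inv_pair_alphaDbeta mulVf ?gt_eqF ?alphaDbeta_gt0//.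
by rewrite /= addr0.
Qed.

Lemma disformal_abelian_group :
  abelian_group_of_maps [set D ab 1 1 | ab in [set: admissible_pair M]].
Proof.
split=> [_ _ [ab _ <-] [ab' _ <-]|_ _ [ab _ <-] [ab' _ <-]|].
- by exists (mul_pair ab ab').
- exact: D1MC.
exists (D unit_pair 1 1); split; first by exists unit_pair.
  by rewrite D1_unit.
move=> _ [ab _ <-]; exists (D (inv_pair ab) 1 1); first by exists (inv_pair ab).
by rewrite (D1MC ab) D1V D1_unit.
Qed.

(* The square of the map attached to the pair (1, 0) has coefficients
   [eps1 ^+ 2] and [eps2 ^+ 2], while all the maps of the family have
   coefficients of the signs of [eps1] and [eps2]. *)
Lemma disformal_closed_signs (eps1 eps2 : R) :
  eps1 = 1 \/ eps1 = -1 -> eps2 = 1 \/ eps2 = -1 ->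
  (exists X p, P (val X p) != 0) -> (exists X p, val X p - P (val X p) != 0) ->
  abelian_group_of_maps [set D ab eps1 eps2 | ab in [set: admissible_pair M]] ->
  eps1 = 1 /\ eps2 = 1.
Proof.
move=> e1 e2 [X [p PX]] [Y [q PY]] [closed _ _].
have [||ab _ Dab] := closed (D unit_pair eps1 eps2) (D unit_pair eps1 eps2).
- by exists unit_pair.
- by exists unit_pair.
(* If [eps] were -1, the equation would read [- z = 1] with [z] positive. *)
have sign (eps z : R) : eps = 1 \/ eps = -1 -> 0 < z -> eps * z = eps * eps -> eps = 1.
  by move=> [->//|->] z0 ?; lra.
have E Z r : combination (@P r) (eps1 * phi (alpha ab r + beta ab r))
    (eps2 * phi (alpha ab r)) (val Z r) =
    combination (@P r) (eps1 * eps1) (eps2 * eps2) (val Z r).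
  by rewrite -DE Dab /= !DE /= combination_comp// addr0 phi1 !mulr1.
split; [apply: sign e1 _ (combination_injl _ _ PX (E X p))
       |apply: sign e2 _ (combination_injr _ _ PY (E Y q))] => //;
  by rewrite phi_gt0 ?alphaDbeta_gt0 ?alpha_gt0.
Qed.

End DisformalGroup.

(** * Disformal maps *)

Section Geometry.
Context {R : realType} {M : spacetime R} (V : vector_field M).
Local Notation g := (st_metric M).
Hypothesis V_timelike : timelike g V.

Let gVV_neq0 p : g p (V p) (V p) != 0.
Proof. by rewrite gt_eqF. Qed.

Section Pointwise.
Context (p : M).
Implicit Types (x y z : tangent p) (w : cotangent p) (a : R).

Let metricC x y : g p x y = g p y x.
Proof. exact: Defs.metric_sym. Qed.

Let metricZDr x a y z : g p x (a *: y + z) = a * g p x y + g p x z.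
Proof. exact: metric_linear. Qed.

Let metricZDl x a y z : g p (a *: y + z) x = a * g p y x + g p z x.
Proof. by rewrite metricC metricZDr !(metricC x). Qed.

Let metric0r x : g p x 0 = 0.
Proof. exact: (cotangent0 (flat g x)). Qed.

Let metric0l x : g p 0 x = 0.
Proof. by rewrite metricC metric0r. Qed.

Lemma flat_linear : linear (@flat _ _ g p).
Proof. by move=> a x y; apply: cotangentP => z; exact: metricZDl. Qed.

Lemma par_linear : linear (@par _ M V p).
Proof.
by move=> a x y; rewrite /par metricZDl mulrDl scalerDl scalerA mulrA.
Qed.

Lemma par_par x : par V (par V x) = par V x.
Proof.
rewrite {1}/par; congr (_ *: _); rewrite /par -[_ *: _]addr0 metricZDl.
by rewrite metric0l addr0 mulfK.
Qed.

Lemma metric_perp x : g p (V p) (x - par V x) = 0.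
Proof.
rewrite addrC /par -scaleNr metricZDr mulNr mulfVK// metricC.
by rewrite addNr.
Qed.

(** Parallel and perpendicular parts are orthogonal, so cross terms vanish; the two brackets are the
    metric on each part. *)
Lemma metric_combination s t y z :
  g p (combination (par V (p:=p)) s t y) (combination (par V (p:=p)) s t z) =
  s ^+ 2 * (g p (V p) y * g p (V p) z / g p (V p) (V p)) +
  t ^+ 2 * (g p y z - g p (V p) y * g p (V p) z / g p (V p) (V p)).
Proof.
(* The trailing [+ 0] gives both summands the shape [a *: y + z] of the linearity rules. *)
have combE x : combination (par V (p:=p)) s t x =
    ((s - t) * (g p (V p) x / g p (V p) (V p))) *: V p + (t *: x + 0).
  rewrite /combination /par scalerBr !scalerA metricC.
  by rewrite addrA addrAC -scalerBl -mulrBl addr0.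
rewrite !combE !(metricZDr, metricZDl, metric0r, metric0l).
rewrite [g p y (V p)]metricC.
by field; exact: gVV_neq0.
Qed.

Lemma disformal_metricE ab y z :
  disformal_metric V ab y z =
  g p (disformal_vec V ab 1 1 y) (disformal_vec V ab 1 1 z).
Proof.
rewrite [RHS]metric_combination !mul1r !sqr_sqrtr ?ltW ?alpha_gt0 ?alphaDbeta_gt0//.
by rewrite /disformal_metric; field.
Qed.

(** The co-metric against [flat g (V p)] is evaluation at [V p], so [sharp] disappears. *)
Lemma coparE w : copar V w = (w (V p) / g p (V p) (V p)) *: flat g (V p).
Proof. by rewrite /copar !cometric_flatr. Qed.

Lemma copar_linear : linear (@copar _ M V p).
Proof.
move=> a w1 w2; rewrite !coparE.
have -> : (a *: w1 + w2) (V p) = a * w1 (V p) + w2 (V p) by [].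
by rewrite mulrDl scalerDl scalerA mulrA.
Qed.

Lemma copar_copar w : copar V (copar V w) = copar V w.
Proof.
rewrite !coparE; have -> a x y : (a *: flat g x) y = a * g p x y by [].
by rewrite mulfK.
Qed.

(** [flat] intertwines the two projectors, which transfers computations from covectors to
    vectors. *)
Lemma copar_flat x : copar V (flat g x) = flat g (par V x).
Proof.
rewrite coparE; apply: cotangentP => y.
by rewrite /= /par -[_ *: V p]addr0 metricZDl metric0l addr0.
Qed.

Lemma combination_copar_flat s t x :
  combination (copar V (p:=p)) s t (flat g x) =
  flat g (combination (par V (p:=p)) s t x).
Proof.
have flat0 : flat g (0 : tangent p) = 0 by apply: cotangentP => y; exact: metric0l.
have subE (W : lmodType R) (u v : W) : u - v = -1 *: v + (u + 0).
  by rewrite addr0 scaleN1r addrC.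
rewrite /combination copar_flat flat_linear -[t *: (x - _)]addr0 flat_linear flat0.
by rewrite [x - _]subE flat_linear [flat g _ - _]subE !addr0.
Qed.

(** Every covector is [flat] of its [sharp], so [metric_combination] applies with squared
    coefficients [1 / (alpha + beta)] and [1 / alpha], whose difference is
    [- beta / (alpha * (alpha + beta))]. *)
Lemma disformal_cometricE ab w1 w2 :
  disformal_cometric V ab w1 w2 =
  cometric g (disformal_covec V ab 1 1 w1) (disformal_covec V ab 1 1 w2).
Proof.
have a0 := alpha_gt0 ab p; have ab0 := alphaDbeta_gt0 ab p.
rewrite -(sharpK g w1) -(sharpK g w2).
rewrite /disformal_covec -!/(combination _ _ _ _) !combination_copar_flat.
rewrite /disformal_cometric !cometric_flat metric_combination.
rewrite !mul1r !exprVn !sqr_sqrtr ?ltW//.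
by field; rewrite gVV_neq0 !gt_eqF.
Qed.

End Pointwise.

Lemma vector_field_ext (X Y : vector_field M) : (forall p, X p = Y p) -> X = Y.
Proof.
case: X Y => [X sX] [Y sY] /= XY.
have {}XY := functional_extensionality_dep XY; subst Y.
by congr VectorField; exact: Prop_irrelevance.
Qed.

Lemma one_form_ext (w1 w2 : one_form M) : (forall p, w1 p = w2 p) -> w1 = w2.
Proof.
case: w1 w2 => [w1 s1] [w2 s2] /= w12.
have {}w12 := functional_extensionality_dep w12; subst w2.
by congr OneForm; exact: Prop_irrelevance.
Qed.

(** * Fields and forms with nonzero parallel and perpendicular parts *)

Lemma par_V p : par V (V p) = V p.
Proof. by rewrite /par divff// scale1r. Qed.

Lemma exists_par_neq0 : exists (X : vector_field M) p, par V (X p) != 0.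
Proof.
have [p _] := st_nonempty M; exists V, p; rewrite par_V.
by apply: contraNneq (gVV_neq0 p) => ->; apply/eqP; exact: (cotangent0 (flat g 0)).
Qed.

(** Two coordinate fields cannot both be multiples of [V] at [p]. Otherwise [X i0 p (f i1) = 0]
    makes the factor of [X i0] or the value [V p (f i1)] zero, against [X i0 p (f i0) = 1] or
    [X i1 p (f i1) = 1]. *)
Lemma exists_perp_neq0 :
  exists (X : vector_field M) p, X p - par V (X p) != 0.
Proof.
have [p _] := st_nonempty M.
have [X [f Xf]] := exists_coordinate_fields p.
pose i0 : 'I_4 := ord0; pose i1 : 'I_4 := ord_max.
have [X0|] := eqVneq (X i0 p - par V (X i0 p)) 0; last by exists (X i0), p.
have [X1|] := eqVneq (X i1 p - par V (X i1 p)) 0; last by exists (X i1), p.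
have XE i h : X i p - par V (X i p) = 0 ->
    X i p h = g p (X i p) (V p) / g p (V p) (V p) * V p h.
  by move=> /eqP; rewrite subr_eq0 => /eqP {1}->.
have := Xf i0 i0; have := Xf i1 i1; have := Xf i0 i1.
rewrite !XE// !eqxx /= => /eqP; rewrite mulf_eq0 => /orP[]/eqP -> /eqP.
  by move=> _ /eqP; rewrite mul0r eq_sym oner_eq0.
by rewrite mulr0 eq_sym oner_eq0.
Qed.

Fact differential_proof (f : smooth_fun M) p :
  (fun x : tangent p => x f) \in @linear_form_pred R M p.
Proof. by apply/asboolP. Qed.

Definition differential (f : smooth_fun M) : one_form M :=
  @OneForm _ _ (fun p => Cotangent (differential_proof f p))
    (fun X => vf_smooth X f).

Definition flat_field (X : vector_field M) : one_form M :=
  @OneForm _ _ (fun p => flat g (X p)) (fun Y => metric_smooth g X Y).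

Lemma exists_copar_neq0 : exists (w : one_form M) p, copar V (w p) != 0.
Proof.
have [p _] := st_nonempty M; exists (flat_field V), p.
rewrite copar_flat par_V; apply: contraNneq (gVV_neq0 p) => fV0.
by rewrite -[g p _ _]/(flat g (V p) (V p)) fV0.
Qed.

(** A nonzero perpendicular vector [x] is a nonzero derivation, so [x f] is nonzero for some [f].
    The parallel part of the differential of [f] kills [x], hence its perpendicular part takes the
    value [x f] there. *)
Lemma exists_coperp_neq0 :
  exists (w : one_form M) p, w p - copar V (w p) != 0.
Proof.
have [X [p Xp]] := exists_perp_neq0; set x := _ - _ in Xp.
have [f xf] : exists f, x f <> 0.
  apply/not_existsP => xf; move/eqP: Xp; apply; apply/val_inj/funext => f.
  by have /contrapT := xf f.
exists (differential f), p; apply/eqP => wp; apply: xf.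
have /(congr1 (fun w : cotangent p => w x)) := wp.
rewrite coparE -[_ x]/(x f - _ * g p (V p) x) metric_perp mulr0 subr0.
exact.
Qed.

End Geometry.

Theorem theorem1 (R : realType) (M : spacetime R) (V : vector_field M)
    (V_timelike : timelike (st_metric M) V) :
  (forall eps1 eps2 : R, eps1 = 1 \/ eps1 = -1 -> eps2 = 1 \/ eps2 = -1 ->
    ((forall (ab : admissible_pair M) (Y Z : vector_field M) (p : M),
        disformal_metric V ab (Y p) (Z p) =
        st_metric M p
          (disformal_field V_timelike ab eps1 eps2 Y p)
          (disformal_field V_timelike ab eps1 eps2 Z p)) /\
     abelian_group_of_maps
       [set disformal_field V_timelike ab eps1 eps2 | ab in [set: admissible_pair M]])
    <-> (eps1 = 1 /\ eps2 = 1))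
  /\
  (forall eps1 eps2 : R, eps1 = 1 \/ eps1 = -1 -> eps2 = 1 \/ eps2 = -1 ->
    ((forall (ab : admissible_pair M) (w1 w2 : one_form M) (p : M),
        disformal_cometric V ab (w1 p) (w2 p) =
        cometric (st_metric M)
          (disformal_one_form V_timelike ab eps1 eps2 w1 p)
          (disformal_one_form V_timelike ab eps1 eps2 w2 p)) /\
     abelian_group_of_maps
       [set disformal_one_form V_timelike ab eps1 eps2 | ab in [set: admissible_pair M]])
    <-> (eps1 = 1 /\ eps2 = 1)).
Proof.
have sqrt_gt0 (x : R) : 0 < x -> 0 < Num.sqrt x by rewrite sqrtr_gt0.
have sqrtM_gt0 (x y : R) : 0 < x -> 0 < y ->
    Num.sqrt (x * y) = Num.sqrt x * Num.sqrt y by move=> /ltW/sqrtrM.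
have sqrtV_gt0 (x : R) : 0 < x -> 0 < (Num.sqrt x)^-1.
  by rewrite invr_gt0 sqrtr_gt0.
have sqrtVM (x y : R) : 0 < x -> 0 < y ->
    (Num.sqrt (x * y))^-1 = (Num.sqrt x)^-1 * (Num.sqrt y)^-1.
  by move=> /ltW x0 _; rewrite sqrtrM// invfM.
have sqrtV1 : (Num.sqrt 1)^-1 = 1 :> R by rewrite sqrtr1 invr1.
(* In all four goals the formula [DE] for the maps holds by conversion. *)
split=> eps1 eps2 e1 e2; split=> [[_]|[-> ->]].
- exact: (@disformal_closed_signs R M (vector_field M)
    (fun p => tangent p : lmodType R) (@vf_val R M) (@par R M V) Num.sqrt
    (disformal_field V_timelike) (par_linear V) (par_par V_timelike) sqrt_gt0
    (sqrtr1 R) (fun _ _ _ _ _ => erefl) _ _ e1 e2 (exists_par_neq0 V_timelike)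
    (exists_perp_neq0 V)).
- split=> [ab Y Z p|]; first exact: disformal_metricE.
  exact: (@disformal_abelian_group R M (vector_field M)
    (fun p => tangent p : lmodType R) (@vf_val R M) (@par R M V) Num.sqrt
    (disformal_field V_timelike) (@vector_field_ext _ _) (par_linear V)
    (par_par V_timelike) (sqrtr1 R) sqrtM_gt0 (fun _ _ _ _ _ => erefl)).
- exact: (@disformal_closed_signs R M (one_form M)
    (fun p => cotangent p : lmodType R) (@form_val R M) (@copar R M V)
    (fun x => (Num.sqrt x)^-1) (disformal_one_form V_timelike)
    (copar_linear V) (copar_copar V_timelike)
    sqrtV_gt0 sqrtV1 (fun _ _ _ _ _ => erefl) _ _ e1 e2
    (exists_copar_neq0 V_timelike) (@exists_coperp_neq0 _ _ _ V_timelike)).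
- split=> [ab w1 w2 p|]; first exact: disformal_cometricE.
  exact: (@disformal_abelian_group R M (one_form M)
    (fun p => cotangent p : lmodType R) (@form_val R M) (@copar R M V)
    (fun x => (Num.sqrt x)^-1) (disformal_one_form V_timelike)
    (@one_form_ext _ _) (copar_linear V)
    (copar_copar V_timelike) sqrtV1 sqrtVM (fun _ _ _ _ _ => erefl)).
Qed.
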